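(* The modulus of continuity of $\varphi_2$ satisfies $$\omega(h,\varphi_2)=h\log(1/h)+O(h)\qquad(0<h\le1).$$
   Context: $\{t\}$ is the fractional part of $t$. $B_2(t)=\{t\}^2-\{t\}+\frac16$ and $\varphi_2(\lambda)=\sum_{n\ge1}B_2(n\lambda)/n^2$ for $\lambda\in\mathbb{R}$. For a function $f$ on $[0,1]$ and $h>0$, $\omega(h,f)=\sup\{|f(x)-f(y)|:0\le x,y\le1,\ |x-y|\le h\}$. The constant implied by $O$ is absolute. *)

(* Defs.v *)
(* Stdlib reals with Coquelicot. *)
From Stdlib Require Import Reals.
From Coquelicot Require Import Coquelicot.
Open Scope R_scope.

(* [frac_part t] is [t] minus its floor, for negative [t] as well. *)
Definition B2 (t : R) : R := (frac_part t) ^ 2 - frac_part t + / 6.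

(* The index is shifted: the term of rank [k] is the summand for n = k + 1.
   The series converges absolutely, so [Series] is its sum. *)
Definition phi2 (lambda : R) : R :=
  Series (fun k : nat => B2 (INR (S k) * lambda) / (INR (S k)) ^ 2).

(* The supremum is taken in the extended reals, so that an unbounded [f]
   yields [p_infty]; only the values of [f] on [0,1] matter. *)
Definition omega (h : R) (f : R -> R) : Rbar :=
  Lub_Rbar (fun d : R => exists x y : R,
    0 <= x <= 1 /\ 0 <= y <= 1 /\ Rabs (x - y) <= h /\ d = Rabs (f x - f y)).

(* Main.v *)
Require Import Defs.
From Stdlib Require Import Reals ZArith Lra Lia.
From Coquelicot Require Import Coquelicot.
Open Scope R_scope.

(** Everything comes from splitting the series at [n = N], the integer part of
    [1/h].

    Upper bound.  [B2] is 1-Lipschitz on the whole line ([B2_lipschitz]), so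
    for [|x - y| <= h] the [n]-th term of [phi2 x - phi2 y] is at most
    [n h / n^2 = h / n], and [n <= N] contributes at most [h] times the
    harmonic number [H_N], that is [h ln(1/h) + O(h)].  The values of [B2] fill
    an interval of length [1/4], so the terms with [n > N] contribute at most
    [(1/4) (1/N) = O(h)].

    Lower bound.  The pair [0], [h] is nearly extremal.  As [B2] is maximal at
    [0], all terms of [phi2 0 - phi2 h] are nonnegative and those with [n > N]
    may be dropped; for [n <= N] one has [0 <= n h <= 1], where [B2] is the
    polynomial [t^2 - t + 1/6], and the term is [h / n - h^2].  Their sum
    [h H_N - N h^2] is at least [h ln(1/h) - h], because [N h <= 1]. *)

(** * The Bernoulli function *)

Lemma B2_bounds (t : R) : / 6 - / 4 <= B2 t <= / 6.
Proof.
  unfold B2. destruct (base_fp t).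
  pose proof (pow2_ge_0 (frac_part t - / 2)). nra.
Qed.

Lemma B2_on_unit_interval (t : R) : 0 <= t <= 1 -> B2 t = t ^ 2 - t + / 6.
Proof.
  intros [H0 H1]. unfold B2.
  destruct (Rlt_le_dec t 1) as [Hlt | Hge].
  - destruct (Int_part_frac_part_spec t 0 t) as [_ <-]; lra.
  - destruct (Int_part_frac_part_spec t 1 0) as [_ <-]; nra.
Qed.

(** Inside one period the derivative [2 {t} - 1] is at most 1 in absolute
    value.  If an integer separates [s] from [t], compare both values with the
    maximum [1/6], attained at that integer: each falls short of it by at most
    the distance to the integer, hence by at most [t - s]. *)
Lemma B2_lipschitz_ordered (s t : R) : s <= t -> Rabs (B2 s - B2 t) <= t - s.
Proof.
  intros Hst. unfold B2.
  pose proof (Rplus_Int_part_frac_part s) as Es.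
  pose proof (Rplus_Int_part_frac_part t) as Et.
  destruct (base_fp s) as [Hs0 Hs1]. destruct (base_fp t) as [Ht0 Ht1].
  set (u := frac_part s) in *. set (v := frac_part t) in *.
  destruct (Z_lt_le_dec (Int_part s) (Int_part t)) as [Hlt | Hle].
  - apply Zlt_le_succ, IZR_le in Hlt. unfold Z.succ in Hlt.
    rewrite plus_IZR in Hlt.
    apply Rabs_le. nra.
  - apply IZR_le in Hle.
    assert (Heq : IZR (Int_part s) = IZR (Int_part t)).
    { apply Rle_antisym; [| exact Hle].
      assert (Int_part s < Int_part t + 1)%Z.
      { apply lt_IZR. rewrite plus_IZR. lra. }
      apply IZR_le. lia. }
    apply Rabs_le. nra.
Qed.

Lemma B2_lipschitz (s t : R) : Rabs (B2 s - B2 t) <= Rabs (s - t).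
Proof.
  destruct (Rle_dec s t) as [H | H].
  - rewrite (Rabs_minus_sym s t), (Rabs_pos_eq (t - s)) by lra.
    now apply B2_lipschitz_ordered.
  - rewrite (Rabs_minus_sym (B2 s)), (Rabs_pos_eq (s - t)) by lra.
    apply B2_lipschitz_ordered. lra.
Qed.

(** * Harmonic sums and the tail of the series of inverse squares *)

Lemma INR_S_pos (k : nat) : 0 < INR (S k).
Proof. apply lt_0_INR. lia. Qed.

Lemma ln_le_sub_1 (x : R) : 0 < x -> ln x <= x - 1.
Proof.
  intros Hx. pose proof (exp_ineq1_le (ln x)) as H.
  rewrite exp_ln in H by exact Hx. lra.
Qed.

(** Both bounds are [ln u <= u - 1], at [u = x / (x + 1)] and at its inverse.
    Summed over the integers, they compare harmonic sums with the logarithm. *)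
Lemma ln_increment_bounds (x : R) :
  0 < x -> / (x + 1) <= ln (x + 1) - ln x <= / x.
Proof.
  intros Hx. split.
  - assert (H : ln (x / (x + 1)) <= x / (x + 1) - 1).
    { apply ln_le_sub_1, Rdiv_lt_0_compat; lra. }
    rewrite ln_div in H by lra.
    replace (x / (x + 1) - 1) with (- / (x + 1)) in H by (field; lra). lra.
  - assert (H : ln ((x + 1) / x) <= (x + 1) / x - 1).
    { apply ln_le_sub_1, Rdiv_lt_0_compat; lra. }
    rewrite ln_div in H by lra.
    replace ((x + 1) / x - 1) with (/ x) in H by (field; lra). lra.
Qed.

Lemma harmonic_bounds (M : nat) :
  ln (INR (S M) + 1) <= sum_f_R0 (fun k => / INR (S k)) M <= 1 + ln (INR (S M)).
Proof.
  induction M as [| M IH].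
  - simpl. pose proof (ln_increment_bounds 1 Rlt_0_1). rewrite ln_1 in *. lra.
  - rewrite tech5. pose proof (INR_S_pos M).
    pose proof (ln_increment_bounds (INR (S M)) ltac:(lra)).
    pose proof (ln_increment_bounds (INR (S (S M))) (INR_S_pos _)).
    rewrite (S_INR (S M)) in *. lra.
Qed.

Lemma is_series_inv_telescope (M : nat) :
  is_series (fun k => / INR (S M + k) - / INR (S (S M + k))) (/ INR (S M)).
Proof.
  assert (Hpart : forall n,
    sum_f_R0 (fun k => / INR (S M + k) - / INR (S (S M + k))) n
    = / INR (S M) - / INR (S (S M + n))).
  { induction n as [| n IH].
    - cbn [sum_f_R0]. now rewrite !Nat.add_0_r.
    - rewrite tech5, IH, Nat.add_succ_r. ring. }
  change (is_lim_seq
    (sum_n (fun k => / INR (S M + k) - / INR (S (S M + k)))) (/ INR (S M))).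
  apply is_lim_seq_ext with (fun n => / INR (S M) - / INR (n + S (S M))).
  { intros n. rewrite sum_n_Reals, Hpart.
    now replace (n + S (S M))%nat with (S (S M + n)) by lia. }
  replace (Finite (/ INR (S M))) with (Finite (/ INR (S M) - 0))
    by now rewrite Rminus_0_r.
  apply is_lim_seq_minus'; [apply is_lim_seq_const |].
  apply (is_lim_seq_incr_n (fun n => / INR n) (S (S M))).
  apply (is_lim_seq_inv INR p_infty); [apply is_lim_seq_INR | discriminate].
Qed.

(** The bound [1 / n^2 <= 1 / (n - 1) - 1 / n] for [n = M + 2 + k] makes the
    tail telescope. *)
Lemma inv_sqr_telescope_bound (M k : nat) :
  0 <= / INR (S (S M + k)) ^ 2 <= / INR (S M + k) - / INR (S (S M + k)).
Proof.
  rewrite (S_INR (S M + k)).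
  pose proof (INR_S_pos (M + k)) as Hx. change (S (M + k)) with (S M + k)%nat in Hx.
  set (x := INR (S M + k)) in *.
  replace (/ x - / (x + 1)) with (/ (x * (x + 1))) by (field; lra).
  split.
  - apply Rlt_le, Rinv_0_lt_compat. nra.
  - apply Rinv_le_contravar; nra.
Qed.

Lemma ex_series_inv_sqr : ex_series (fun k => / INR (S k) ^ 2).
Proof.
  apply (ex_series_incr_n _ 1).
  apply (ex_series_le (V := R_CompleteNormedModule)) with
    (fun k => / INR (1 + k) - / INR (S (1 + k)));
    [| eexists; apply (is_series_inv_telescope 0)].
  intros k. pose proof (inv_sqr_telescope_bound 0 k).
  change norm with Rabs.
  rewrite Rabs_pos_eq; apply H.
Qed.

Lemma Series_inv_sqr_tail (M : nat) :
  Series (fun k => / INR (S (S M + k)) ^ 2) <= / INR (S M).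
Proof.
  rewrite <- (is_series_unique _ _ (is_series_inv_telescope M)).
  apply Series_le.
  - apply inv_sqr_telescope_bound.
  - eexists. apply is_series_inv_telescope.
Qed.

(** * Increments of [phi2] *)

(** Two competing bounds on the terms, [d / n] and [c / n^2], are used on
    either side of the cut at [n = M + 1]. *)
Lemma Series_split_bound (a : nat -> R) (d c : R) (M : nat) :
  (forall k, Rabs (a k) <= d * / INR (S k)) ->
  (forall k, Rabs (a k) <= c * / INR (S k) ^ 2) ->
  Rabs (Series a) <=
    d * sum_f_R0 (fun k => / INR (S k)) M + c * / INR (S M).
Proof.
  intros Hhead Htail.
  assert (Hc : 0 <= c).
  { specialize (Htail 0%nat). pose proof (Rabs_pos (a 0%nat)).
    simpl in Htail. replace (c * / (1 * (1 * 1))) with c in Htail by field. lra. }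
  assert (Hex : ex_series (fun k => c * / INR (S k) ^ 2)).
  { apply (ex_series_scal c (fun k => / INR (S k) ^ 2)), ex_series_inv_sqr. }
  assert (Hexa : ex_series (fun k => Rabs (a k))).
  { apply (ex_series_le (V := R_CompleteNormedModule)) with (2 := Hex).
    intros k. change norm with Rabs. now rewrite Rabs_Rabsolu. }
  eapply Rle_trans; [now apply Series_Rabs |].
  rewrite (Series_incr_n _ (S M)) by (lia || exact Hexa).
  apply Rplus_le_compat.
  - rewrite scal_sum. apply sum_Rle. intros k _. rewrite Rmult_comm. apply Hhead.
  - eapply Rle_trans.
    + apply Series_le with (b := fun k => c * / INR (S (S M + k)) ^ 2).
      * intros k. split; [apply Rabs_pos | apply Htail].
      * apply (ex_series_incr_n (fun k => c * / INR (S k) ^ 2) (S M)), Hex.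
    + rewrite Series_scal_l. apply Rmult_le_compat_l; [exact Hc |].
      apply Series_inv_sqr_tail.
Qed.

Lemma ex_series_phi2 (x : R) :
  ex_series (fun k => B2 (INR (S k) * x) / INR (S k) ^ 2).
Proof.
  apply (ex_series_le (V := R_CompleteNormedModule)) with (2 := ex_series_inv_sqr).
  intros k. change norm with Rabs.
  pose proof (pow_lt _ 2 (INR_S_pos k)) as Hp.
  unfold Rdiv. rewrite Rabs_mult, (Rabs_pos_eq (/ _))
    by (apply Rlt_le, Rinv_0_lt_compat, Hp).
  rewrite <- (Rmult_1_l (/ _)) at 2.
  apply Rmult_le_compat_r; [apply Rlt_le, Rinv_0_lt_compat, Hp |].
  apply Rabs_le. pose proof (B2_bounds (INR (S k) * x)). lra.
Qed.

Lemma phi2_increment (x y : R) :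
  phi2 x - phi2 y =
  Series (fun k => (B2 (INR (S k) * x) - B2 (INR (S k) * y)) / INR (S k) ^ 2).
Proof.
  unfold phi2. rewrite <- Series_minus by apply ex_series_phi2.
  apply Series_ext. intros k. unfold Rdiv. ring.
Qed.

Lemma phi2_increment_upper (x y h : R) (M : nat) :
  Rabs (x - y) <= h ->
  Rabs (phi2 x - phi2 y) <=
    h * sum_f_R0 (fun k => / INR (S k)) M + / 4 * / INR (S M).
Proof.
  intros Hxy. rewrite phi2_increment.
  assert (Habs : forall k u, Rabs (u / INR (S k) ^ 2) = Rabs u * / INR (S k) ^ 2).
  { intros k u. unfold Rdiv. rewrite Rabs_mult, (Rabs_pos_eq (/ _)); [easy |].
    apply Rlt_le, Rinv_0_lt_compat, pow_lt, INR_S_pos. }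
  apply Series_split_bound; intros k; rewrite Habs; pose proof (INR_S_pos k) as Hk.
  - replace (h * / INR (S k)) with (INR (S k) * h * / INR (S k) ^ 2)
      by (field; lra).
    apply Rmult_le_compat_r; [apply Rlt_le, Rinv_0_lt_compat, pow_lt, Hk |].
    eapply Rle_trans; [apply B2_lipschitz |].
    rewrite <- Rmult_minus_distr_l, Rabs_mult, (Rabs_pos_eq (INR (S k))) by lra.
    now apply Rmult_le_compat_l; [lra |].
  - apply Rmult_le_compat_r; [apply Rlt_le, Rinv_0_lt_compat, pow_lt, Hk |].
    apply Rabs_le. pose proof (B2_bounds (INR (S k) * x)).
    pose proof (B2_bounds (INR (S k) * y)). lra.
Qed.

Lemma phi2_increment_lower (h : R) (M : nat) :
  0 <= h -> INR (S M) * h <= 1 ->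
  h * sum_f_R0 (fun k => / INR (S k)) M - INR (S M) * h ^ 2 <= phi2 0 - phi2 h.
Proof.
  intros Hh HM. rewrite phi2_increment.
  set (a := fun k => (B2 (INR (S k) * 0) - B2 (INR (S k) * h)) / INR (S k) ^ 2).
  assert (H0 : forall k, B2 (INR (S k) * 0) = / 6).
  { intros k. rewrite Rmult_0_r, B2_on_unit_interval by lra. ring. }
  assert (Hex : ex_series a).
  { eapply ex_series_ext;
      [| exact (ex_series_minus _ _ (ex_series_phi2 0) (ex_series_phi2 h))].
    intros k. unfold a, Rdiv. rewrite Rmult_minus_distr_r. reflexivity. }
  assert (Hpos : forall k, 0 <= a k).
  { intros k. apply Rmult_le_pos.
    - rewrite H0. pose proof (B2_bounds (INR (S k) * h)). lra.
    - apply Rlt_le, Rinv_0_lt_compat, pow_lt, INR_S_pos. }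
  assert (Htail : 0 <= Series (fun k => a (S M + k)%nat)).
  { rewrite <- (Rmult_0_l (Series (fun k => a (S M + k)%nat))),
      <- Series_scal_l.
    apply Series_le.
    - intros k. pose proof (Hpos (S M + k)%nat). lra.
    - now apply ex_series_incr_n. }
  rewrite (Series_incr_n a (S M)) by (lia || exact Hex). simpl Init.Nat.pred.
  enough (sum_f_R0 a M
    = h * sum_f_R0 (fun k => / INR (S k)) M - INR (S M) * h ^ 2) by lra.
  rewrite Rmult_comm with (r1 := INR (S M)), <- sum_cte, scal_sum, <- minus_sum.
  apply sum_eq. intros k Hk. unfold a. rewrite H0.
  pose proof (INR_S_pos k) as Hkpos.
  assert (INR (S k) <= INR (S M)) by (apply le_INR; lia).
  rewrite B2_on_unit_interval by nra. field. lra.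
Qed.

(** * The modulus of continuity *)

Lemma inv_floor (h : R) :
  0 < h <= 1 -> exists M : nat, INR (S M) <= 1 / h < INR (S M) + 1.
Proof.
  intros Hh.
  assert (H1 : 1 <= 1 / h) by (apply Rle_div_r; lra).
  destruct (nfloor_ex (1 / h)) as [[| M] HM]; [lra | simpl in HM; lra |].
  now exists M.
Qed.

Lemma omega_enclosure (f : R -> R) (h x y lo hi : R) :
  0 <= x <= 1 -> 0 <= y <= 1 -> Rabs (x - y) <= h ->
  lo <= Rabs (f x - f y) ->
  (forall x' y', Rabs (x' - y') <= h -> Rabs (f x' - f y') <= hi) ->
  is_finite (omega h f) /\ lo <= real (omega h f) <= hi.
Proof.
  intros Hx Hy Hxy Hlo Hhi.
  destruct (Lub_Rbar_correct (fun d => exists x y : R,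
    0 <= x <= 1 /\ 0 <= y <= 1 /\ Rabs (x - y) <= h /\ d = Rabs (f x - f y)))
    as [Hub Hleast].
  fold (omega h f) in Hub, Hleast.
  assert (Hge : Rbar_le (Rabs (f x - f y)) (omega h f)).
  { apply Hub. now exists x, y. }
  assert (Hle : Rbar_le (omega h f) hi).
  { apply Hleast. intros d (x' & y' & _ & _ & Hd & ->). now apply Hhi. }
  destruct (omega h f) as [w | |]; simpl in Hge, Hle; try easy.
  split; [reflexivity | simpl; lra].
Qed.

Theorem proposition27 :
  exists C : R, forall h : R, 0 < h <= 1 ->
    is_finite (omega h phi2) /\
    Rabs (real (omega h phi2) - h * ln (1 / h)) <= C * h.
Proof.
  exists 2. intros h Hh.
  destruct (inv_floor h Hh) as [M [HM1 HM2]].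
  pose proof (INR_S_pos M) as HMpos.
  assert (HMh : INR (S M) * h <= 1) by (apply Rle_div_r; lra).
  (* With N = M + 1 >= 1: 1 / h < N + 1 <= 2 N. *)
  assert (Hinv : / INR (S M) <= 2 * h).
  { assert (1 <= INR (S M)) by (apply (le_INR 1); lia).
    apply Rlt_div_l in HM2; [| lra].
    apply Rmult_le_reg_l with (INR (S M)); [lra |].
    rewrite Rinv_r by lra. nra. }
  destruct (harmonic_bounds M) as [HlnL HlnU].
  assert (ln (INR (S M)) <= ln (1 / h)) by (apply ln_le; lra).
  assert (ln (1 / h) <= ln (INR (S M) + 1)) by (apply ln_le; lra).
  destruct (omega_enclosure phi2 h 0 h (h * ln (1 / h) - h)
              (h * ln (1 / h) + 2 * h)) as [Hfin Henc].
  - lra.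
  - lra.
  - rewrite Rminus_0_l, Rabs_Ropp, Rabs_pos_eq; lra.
  - eapply Rle_trans; [| apply Rle_abs].
    eapply Rle_trans; [| apply phi2_increment_lower with (M := M); lra].
    nra.
  - intros x y Hxy.
    eapply Rle_trans; [apply phi2_increment_upper with (M := M), Hxy |].
    nra.
  - split; [exact Hfin | apply Rabs_le; lra].
Qed.
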